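(* Let $T$ and $R$ be rings and let $M$ be a Frobenius $(T,R)$-bimodule. Let $e=\sum_i m_i\otimes_R f_i\in M\otimes_R{}^*M$ with $te=et$ for all $t\in T$, and let $\overline{\nu}:\mathrm{Hom}({}_TM,{}_TM)\to R$ be an $R$-bimodule map, such that $$m=\sum_i m_i\,\overline{\nu}(f_i\cdot m)\quad\text{and}\quad f=\sum_i\overline{\nu}(f\cdot m_i)f_i$$ for all $m\in M$ and $f\in{}^*M$. Then $T$ is $M$-separable over $R$ (equivalently, the functor $G=\mathrm{Hom}({}_TM,{}_T\bullet)$ from left $T$-modules to left $R$-modules is separable) if and only if there exists a $(T,R)$-bimodule map $\overline{\alpha}:M\to M$ such that $$\sum_i(\overline{\alpha}(m_i))f_i=1_T.$$
   Context: Rings are unital associative, modules unitary. For a $(T,R)$-bimodule $M$: $M^*=\mathrm{Hom}(M_R,R_R)$ is an $(R,T)$-bimodule via $(rht)(m)=r\,h(tm)$; ${}^*M=\mathrm{Hom}({}_TM,{}_TT)$, with maps written on the right of their arguments, is an $(R,T)$-bimodule via $(m)(rft)=((mr)f)t$; and $\mathrm{Hom}({}_TM,{}_TM)$ is an $R$-bimodule via $(m)(rfr')=((mr)f)r'$. For $f\in{}^*M$ and $m\in M$, $f\cdot m\in\mathrm{Hom}({}_TM,{}_TM)$ is the map $m'\mapsto (m')f\,m$. $M$ is a Frobenius bimodule if $M_R$ and ${}_TM$ are finitely generated projective and ${}^*M\cong M^*$ as $(R,T)$-bimodules. (For a Frobenius bimodule such $e$ and $\overline\nu$ exist.) $T$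 is $M$-separable over $R$ if the $T$-bimodule map $M\otimes_R{}^*M\to T$, $m\otimes f\mapsto (m)f$, is a split epimorphism of $T$-bimodules. A functor $G:\mathcal{A}\to\mathcal{B}$ is separable if the natural transformation $\mathrm{Hom}_{\mathcal A}(\bullet,\bullet)\to\mathrm{Hom}_{\mathcal B}(G(\bullet),G(\bullet))$, $f\mapsto G(f)$, has a natural left inverse. The left $R$-module structure on $\mathrm{Hom}({}_TM,{}_TQ)$ is $(m)(rf)=(mr)f$. *)

(* Defs.v *)
From HB Require Import structures.
From mathcomp Require Import all_boot all_algebra generic_quotient boolp.
From mathcomp Require Import freeg.

Set Implicit Arguments.
Unset Strict Implicit.
Unset Printing Implicit Defensive.

Import GRing.Theory.
Local Open Scope ring_scope.
Local Open Scope quotient_scope.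

(* Rings are [pzRingType]s, so the zero ring is allowed.  A (T,R)-bimodule is *)
(* a left T-module together with a compatible right action of R, written      *)
(* [x ** r].                                                                  *)

HB.mixin Record Lmodule_isBimodule (T R : pzRingType) M of GRing.Lmodule T M :=
{
  rscale : M -> R -> M;
  rscaleA : forall x a b, rscale (rscale x a) b = rscale x (a * b);
  rscale1 : forall x, rscale x 1 = x;
  rscaleDl : forall x y a, rscale (x + y) a = rscale x a + rscale y a;
  rscaleDr : forall x a b, rscale x (a + b) = rscale x a + rscale x b;
  scalerscaleA : forall (t : T) x a, t *: rscale x a = rscale (t *: x) a
}.

#[short(type="bimodType")]
HB.structure Definition Bimodule (T R : pzRingType) :=
  {M of GRing.Lmodule T M & Lmodule_isBimodule T R M}.

Notation "x ** a" := (rscale x a) (at level 40, left associativity) :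
  ring_scope.

Section BimoduleTheory.
Context (T R : pzRingType) (M : bimodType T R).
Implicit Types (x y : M) (a b : R).

Lemma rscale0 x : x ** (0 : R) = 0.
Proof. by apply: (addrI (x ** (0 : R))); rewrite -rscaleDr !addr0. Qed.

Lemma rscale0l a : (0 : M) ** a = 0.
Proof. by apply: (addrI ((0 : M) ** a)); rewrite -rscaleDl !addr0. Qed.

End BimoduleTheory.

(* A bimodule map is a left linear map that is moreover [rscalable]. *)
Definition rscalable (T R : pzRingType) (M N : bimodType T R) (f : M -> N) :=
  forall x (a : R), f (x ** a) = f x ** a.

Section RegularBimodule.
Context (R : pzRingType).

Let regular_rscale (x : R^o) (a : R) : R^o := (x : R) * a.

Fact regular_rscaleA x a b :
  regular_rscale (regular_rscale x a) b = regular_rscale x (a * b).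
Proof. by rewrite /regular_rscale mulrA. Qed.
Fact regular_rscale1 x : regular_rscale x 1 = x.
Proof. exact: mulr1. Qed.
Fact regular_rscaleDl x y a :
  regular_rscale (x + y) a = regular_rscale x a + regular_rscale y a.
Proof. exact: mulrDl. Qed.
Fact regular_rscaleDr x a b :
  regular_rscale x (a + b) = regular_rscale x a + regular_rscale x b.
Proof. exact: mulrDr. Qed.
Fact regular_scalerscaleA (t : R) (x : R^o) a :
  t *: regular_rscale x a = regular_rscale (t *: x) a.
Proof. exact: (mulrA t x a). Qed.

HB.instance Definition _ := Lmodule_isBimodule.Build R R R^o
  regular_rscaleA regular_rscale1 regular_rscaleDl regular_rscaleDr
  regular_scalerscaleA.

End RegularBimodule.

(* M_R, a right R-module being a left module over the converse ring. *)
Definition rmod (T R : pzRingType) (M : bimodType T R) : Type := M.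

Section RightModule.
Context (T R : pzRingType) (M : bimodType T R).

HB.instance Definition _ := GRing.Zmodule.on (rmod M).

Let rmod_scale (a : R^c) (x : rmod M) : rmod M := (x : M) ** (a : R).

Fact rmod_scaleA a b x :
  rmod_scale a (rmod_scale b x) = rmod_scale (a * b) x.
Proof. exact: (@rscaleA T R M). Qed.
Fact rmod_scale1 : left_id 1 rmod_scale.
Proof. exact: (@rscale1 T R M). Qed.
Fact rmod_scaleDr : right_distributive rmod_scale +%R.
Proof. by move=> a x y; apply: (@rscaleDl T R M). Qed.
Fact rmod_scaleDl x : {morph rmod_scale^~ x : a b / a + b}.
Proof. by move=> a b; apply: (@rscaleDr T R M). Qed.

HB.instance Definition _ := GRing.Zmodule_isLmodule.Build R^c (rmod M)
  rmod_scaleA rmod_scale1 rmod_scaleDr rmod_scaleDl.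

End RightModule.

Lemma linear_ext (R : pzRingType) (U V : lmodType R) (f g : {linear U -> V}) :
  f =1 g -> f = g.
Proof.
case: f g => [f [[[f1 f2]] [f3]]] [g [[[g1 g2]] [g3]]] /= /funext fg.
case: g / fg g1 g2 g3 => g1 g2 g3.
by rewrite (Prop_irrelevance f1 g1) (Prop_irrelevance f2 g2)
  (Prop_irrelevance f3 g3).
Qed.

(* Hom(_T M, _T Q), a left R-module via (m)(rf) = (mr)f.                      *)
Definition lhom (T R : pzRingType) (M : bimodType T R) (Q : lmodType T) : Type :=
  {linear M -> Q}.

Section LeftHom.
Context (T R : pzRingType) (M : bimodType T R) (Q : lmodType T).
Implicit Types (f g h : lhom M Q) (a b : R).

HB.instance Definition _ := gen_eqMixin (lhom M Q).
HB.instance Definition _ := gen_choiceMixin (lhom M Q).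

Definition lhom_zero : lhom M Q := GRing.Linear.clone _ _ _ _ (\0 : M -> Q) _.
Definition lhom_opp f : lhom M Q := GRing.Linear.clone _ _ _ _ (\- f) _.
Definition lhom_add f g : lhom M Q := GRing.Linear.clone _ _ _ _ (f \+ g) _.

Definition lhom_scale_fun a f (x : M) : Q := f (x ** a).

Fact lhom_scale_fun_linear a f : linear (lhom_scale_fun a f).
Proof.
by move=> t x y; rewrite /lhom_scale_fun rscaleDl -scalerscaleA linearP.
Qed.
HB.instance Definition _ a f :=
  GRing.isLinear.Build T M Q *:%R (lhom_scale_fun a f)
    (lhom_scale_fun_linear a f).
Definition lhom_scale a f : lhom M Q := lhom_scale_fun a f.

Fact lhom_addA : associative lhom_add.
Proof. by move=> f g h; apply: linear_ext => x /=; rewrite addrA. Qed.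
Fact lhom_addC : commutative lhom_add.
Proof. by move=> f g; apply: linear_ext => x /=; rewrite addrC. Qed.
Fact lhom_add0 : left_id lhom_zero lhom_add.
Proof. by move=> f; apply: linear_ext => x /=; rewrite add0r. Qed.
Fact lhom_addN : left_inverse lhom_zero lhom_opp lhom_add.
Proof. by move=> f; apply: linear_ext => x /=; rewrite addNr. Qed.

HB.instance Definition _ := GRing.isZmodule.Build (lhom M Q)
  lhom_addA lhom_addC lhom_add0 lhom_addN.

Fact lhom_scaleA a b f : lhom_scale a (lhom_scale b f) = lhom_scale (a * b) f.
Proof.
by apply: linear_ext => x; rewrite /= /lhom_scale_fun /= /lhom_scale_fun rscaleA.
Qed.
Fact lhom_scale1 : left_id 1 lhom_scale.
Proof.
by move=> f; apply: linear_ext => x; rewrite /= /lhom_scale_fun rscale1.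
Qed.
Fact lhom_scaleDr : right_distributive lhom_scale +%R.
Proof. by move=> a f g; apply: linear_ext. Qed.
Fact lhom_scaleDl f : {morph lhom_scale^~ f : a b / a + b}.
Proof.
by move=> a b; apply: linear_ext => x; rewrite /= /lhom_scale_fun rscaleDr linearD.
Qed.

HB.instance Definition _ := GRing.Zmodule_isLmodule.Build R (lhom M Q)
  lhom_scaleA lhom_scale1 lhom_scaleDr lhom_scaleDl.

Lemma lhom0E x : (0 : lhom M Q) x = 0. Proof. by []. Qed.
Lemma lhomDE f g x : (f + g) x = f x + g x. Proof. by []. Qed.
Lemma lhomNE f x : (- f) x = - f x. Proof. by []. Qed.
Lemma lhomZE a f x : (a *: f) x = f (x ** a). Proof. by []. Qed.

End LeftHom.

(* When N is a (T,S)-bimodule, Hom(_T M, _T N) is an (R,S)-bimodule via       *)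
(* (m)(rfs) = ((mr)f)s.                                                       *)
Section LeftHomBimodule.
Context (T R S : pzRingType) (M : bimodType T R) (N : bimodType T S).
Implicit Types (f g : lhom M N) (a b : S).

Definition lhom_rscale_fun f a (x : M) : N := f x ** a.

Fact lhom_rscale_fun_linear f a : linear (lhom_rscale_fun f a).
Proof.
by move=> t x y; rewrite /lhom_rscale_fun linearP rscaleDl scalerscaleA.
Qed.
HB.instance Definition _ f a :=
  GRing.isLinear.Build T M N *:%R (lhom_rscale_fun f a)
    (lhom_rscale_fun_linear f a).
Definition lhom_rscale f a : lhom M N := lhom_rscale_fun f a.

Fact lhom_rscaleA f a b :
  lhom_rscale (lhom_rscale f a) b = lhom_rscale f (a * b).
Proof. by apply: linear_ext => x; apply: rscaleA. Qed.
Fact lhom_rscale1 f : lhom_rscale f 1 = f.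
Proof. by apply: linear_ext => x; apply: rscale1. Qed.
Fact lhom_rscaleDl f g a :
  lhom_rscale (f + g) a = lhom_rscale f a + lhom_rscale g a.
Proof. by apply: linear_ext => x; apply: rscaleDl. Qed.
Fact lhom_rscaleDr f a b :
  lhom_rscale f (a + b) = lhom_rscale f a + lhom_rscale f b.
Proof. by apply: linear_ext => x; apply: rscaleDr. Qed.
Fact lhom_scalerscaleA (r : R) f a :
  r *: lhom_rscale f a = lhom_rscale (r *: f) a.
Proof. exact: linear_ext. Qed.

HB.instance Definition _ := Lmodule_isBimodule.Build R S (lhom M N)
  lhom_rscaleA lhom_rscale1 lhom_rscaleDl lhom_rscaleDr lhom_scalerscaleA.

Lemma lhom_rscaleE f a x : (f ** a) x = f x ** a. Proof. by []. Qed.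

End LeftHomBimodule.

(* M^* = Hom(M_R, R_R), an (R,T)-bimodule via (rht)(m) = r h(tm); the left    *)
(* dual *M is [lhom M T^o].                                                   *)
Definition rdual (T R : pzRingType) (M : bimodType T R) : Type :=
  {linear rmod M -> (R^c)^o}.

Section RightDual.
Context (T R : pzRingType) (M : bimodType T R).
Implicit Types (f g h : rdual M) (a b : R) (s t : T).

HB.instance Definition _ := gen_eqMixin (rdual M).
HB.instance Definition _ := gen_choiceMixin (rdual M).

Definition rdual_app h (x : M) : R := h x.
Local Notation app := rdual_app.

Lemma rdual_ext f g : (forall x, app f x = app g x) -> f = g.
Proof. exact: (@linear_ext R^c (rmod M) (R^c)^o). Qed.

Lemma rdual_appD h (x y : M) : app h (x + y) = app h x + app h y.
Proof. exact: (linearD h (x : rmod M) y). Qed.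
Lemma rdual_appZ h (x : M) a : app h (x ** a) = app h x * a.
Proof. exact: (linearZ_LR h (a : R^c) (x : rmod M)). Qed.

Definition rdual_zero : rdual M :=
  GRing.Linear.clone _ _ _ _ (\0 : rmod M -> (R^c)^o) _.
Definition rdual_opp f : rdual M := GRing.Linear.clone _ _ _ _ (\- f) _.
Definition rdual_add f g : rdual M := GRing.Linear.clone _ _ _ _ (f \+ g) _.

Definition rdual_scale_fun a h (x : rmod M) : (R^c)^o := a * app h x.
Definition rdual_rscale_fun h t (x : rmod M) : (R^c)^o := app h (t *: (x : M)).

Fact rdual_scale_fun_linear a h : linear (rdual_scale_fun a h).
Proof.
move=> r x y.
suff: a * app h ((x : M) ** (r : R) + (y : M)) =
      a * app h x * (r : R) + a * app h y by [].
by rewrite rdual_appD rdual_appZ mulrDr mulrA.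
Qed.
HB.instance Definition _ a h :=
  GRing.isLinear.Build R^c (rmod M) (R^c)^o *:%R (rdual_scale_fun a h)
    (rdual_scale_fun_linear a h).
Definition rdual_scale a h : rdual M := rdual_scale_fun a h.

Fact rdual_rscale_fun_linear h t : linear (rdual_rscale_fun h t).
Proof.
move=> r x y.
suff: app h (t *: ((x : M) ** (r : R) + (y : M))) =
      app h (t *: (x : M)) * (r : R) + app h (t *: (y : M)) by [].
by rewrite scalerDr scalerscaleA rdual_appD rdual_appZ.
Qed.
HB.instance Definition _ h t :=
  GRing.isLinear.Build R^c (rmod M) (R^c)^o *:%R (rdual_rscale_fun h t)
    (rdual_rscale_fun_linear h t).
Definition rdual_rscale h t : rdual M := rdual_rscale_fun h t.

Fact rdual_addA : associative rdual_add.
Proof. by move=> f g h; apply: rdual_ext => x; apply: addrA. Qed.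
Fact rdual_addC : commutative rdual_add.
Proof. by move=> f g; apply: rdual_ext => x; apply: addrC. Qed.
Fact rdual_add0 : left_id rdual_zero rdual_add.
Proof. by move=> f; apply: rdual_ext => x; apply: add0r. Qed.
Fact rdual_addN : left_inverse rdual_zero rdual_opp rdual_add.
Proof. by move=> f; apply: rdual_ext => x; apply: addNr. Qed.

HB.instance Definition _ := GRing.isZmodule.Build (rdual M)
  rdual_addA rdual_addC rdual_add0 rdual_addN.

Fact rdual_scaleA a b h :
  rdual_scale a (rdual_scale b h) = rdual_scale (a * b) h.
Proof. by apply: rdual_ext => x; apply: (mulrA a b). Qed.
Fact rdual_scale1 : left_id 1 rdual_scale.
Proof. by move=> h; apply: rdual_ext => x; apply: mul1r. Qed.
Fact rdual_scaleDr : right_distributive rdual_scale +%R.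
Proof. by move=> a f g; apply: rdual_ext => x; apply: mulrDr. Qed.
Fact rdual_scaleDl h : {morph rdual_scale^~ h : a b / a + b}.
Proof. by move=> a b; apply: rdual_ext => x; apply: mulrDl. Qed.

HB.instance Definition _ := GRing.Zmodule_isLmodule.Build R (rdual M)
  rdual_scaleA rdual_scale1 rdual_scaleDr rdual_scaleDl.

Fact rdual_rscaleA h s t :
  rdual_rscale (rdual_rscale h s) t = rdual_rscale h (s * t).
Proof.
by apply: rdual_ext => x; apply: (congr1 (app h)); rewrite scalerA.
Qed.
Fact rdual_rscale1 h : rdual_rscale h 1 = h.
Proof.
by apply: rdual_ext => x; apply: (congr1 (app h)); rewrite scale1r.
Qed.
Fact rdual_rscaleDl f g t :
  rdual_rscale (f + g) t = rdual_rscale f t + rdual_rscale g t.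
Proof. exact: rdual_ext. Qed.
Fact rdual_rscaleDr h s t :
  rdual_rscale h (s + t) = rdual_rscale h s + rdual_rscale h t.
Proof.
apply: rdual_ext => x.
suff: app h ((s + t) *: x) = app h (s *: x) + app h (t *: x) by [].
by rewrite scalerDl rdual_appD.
Qed.
Fact rdual_scalerscaleA a h t :
  a *: rdual_rscale h t = rdual_rscale (a *: h) t.
Proof. exact: rdual_ext. Qed.

HB.instance Definition _ := Lmodule_isBimodule.Build R T (rdual M)
  rdual_rscaleA rdual_rscale1 rdual_rscaleDl rdual_rscaleDr rdual_scalerscaleA.

Lemma rdualZE a h x : app (a *: h) x = a * app h x. Proof. by []. Qed.
Lemma rdual_rscaleE h t x : app (h ** t) x = app h (t *: x). Proof. by []. Qed.

End RightDual.

(* The tensor product M (x)_R N of a (T,R)- and an (R,S)-bimodule: the free   *)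
(* abelian group on M * N modulo the subgroup generated by the biadditivity   *)
(* and R-balancedness relations.                                              *)
Section Tensor.
Context (T R S : pzRingType) (M : bimodType T R) (N : bimodType R S).

Notation F := {freeg (M * N)%type}.

Inductive tensor_null : F -> Prop :=
| tensor_null0 : tensor_null 0
| tensor_nullB u v : tensor_null u -> tensor_null v -> tensor_null (u - v)
| tensor_nullDl x x' y :
    tensor_null (<< (x + x', y) >> - << (x, y) >> - << (x', y) >>)
| tensor_nullDr x y y' :
    tensor_null (<< (x, y + y') >> - << (x, y) >> - << (x, y') >>)
| tensor_nullZ x (a : R) y :
    tensor_null (<< (x ** a, y) >> - << (x, a *: y) >>).

Definition tensor_nullb : {pred F} := fun u => `[< tensor_null u >].

Fact tensor_nullb_zmod : zmod_closed tensor_nullb.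
Proof.
split=> [|u v]; first by apply/asboolP/tensor_null0.
by move=> /asboolP uN /asboolP vN; apply/asboolP/tensor_nullB.
Qed.
HB.instance Definition _ := GRing.isZmodClosed.Build F tensor_nullb
  tensor_nullb_zmod.

Definition tensor : Type := Quotient.quot tensor_nullb.
HB.instance Definition _ := GRing.Zmodule.on tensor.

Definition tens (x : M) (y : N) : tensor :=
  \pi_(Quotient.quot tensor_nullb) (<< (x, y) >> : F).

Let piQ : {additive F -> Quotient.quot tensor_nullb} :=
  \pi_(Quotient.quot tensor_nullb).

Let pi_null (u : F) : tensor_null u -> piQ u = 0.
Proof.
move=> uN; rewrite -(raddf0 piQ); apply/eqP.
by rewrite -Quotient.idealrBE subr0; apply/asboolP.
Qed.

Lemma tensDl x x' y : tens (x + x') y = tens x y + tens x' y.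
Proof.
have := pi_null (tensor_nullDl x x' y).
by rewrite !raddfB -addrA -opprD => /eqP; rewrite subr_eq0 => /eqP.
Qed.

Lemma tensDr x y y' : tens x (y + y') = tens x y + tens x y'.
Proof.
have := pi_null (tensor_nullDr x y y').
by rewrite !raddfB -addrA -opprD => /eqP; rewrite subr_eq0 => /eqP.
Qed.

Lemma tensZ x (a : R) y : tens (x ** a) y = tens x (a *: y).
Proof.
have := pi_null (tensor_nullZ x a y).
by rewrite raddfB => /eqP; rewrite subr_eq0 => /eqP.
Qed.

Lemma tens0l y : tens 0 y = 0.
Proof. by apply: (addrI (tens 0 y)); rewrite -tensDl !addr0. Qed.

Lemma tens0r x : tens x 0 = 0.
Proof. by apply: (addrI (tens x 0)); rewrite -tensDr !addr0. Qed.

Lemma tensNl x y : tens (- x) y = - tens x y.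
Proof. by apply: (addrI (tens x y)); rewrite -tensDl !subrr tens0l. Qed.

Lemma tensor_ind (P : tensor -> Prop) :
  P 0 -> (forall u v, P u -> P v -> P (u + v)) -> (forall x y, P (tens x y)) ->
  forall u, P u.
Proof.
move=> P0 PD Pt u.
have -> : u = piQ (repr (u : Quotient.quot tensor_nullb)).
  exact: (esym (@reprK _ (Quotient.quot tensor_nullb) u)).
rewrite -[repr _]freeg_sumE raddf_sum; elim/big_ind: _ => // -[x y] _.
have PX k : P (piQ << k%:Z *g (x, y) >>).
  elim: k => [|k IHk]; first by rewrite freegU0 raddf0.
  by rewrite intS -freegUD raddfD; apply: PD => //; apply: Pt.
case: (coeff _ _) => [k|k]; first exact: PX.
have PN j : P (- piQ << j%:Z *g (x, y) >>).
  elim: j => [|j IHj]; first by rewrite freegU0 raddf0 oppr0.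
  rewrite intS -freegUD raddfD opprD; apply: PD => //.
  by rewrite -[- _](tensNl x y); apply: Pt.
by rewrite NegzE -freegUN raddfN; apply: PN.
Qed.

Section Lift.
Context (A : zmodType) (phi : M -> N -> A).

Definition balanced :=
  [/\ forall x x' y, phi (x + x') y = phi x y + phi x' y,
      forall x y y', phi x (y + y') = phi x y + phi x y'
    & forall x (a : R) y, phi (x ** a) y = phi x (a *: y)].

Let lift (u : F) : zmodule A :=
  fglift (fun p : M * N => phi p.1 p.2 : zmodule A) u.

Definition tensor_lift (u : tensor) : A :=
  lift (repr (u : Quotient.quot tensor_nullb)).

Hypothesis phiB : balanced.

Let liftB : {morph lift : u v / u - v}.
Proof. exact: lift_is_additive. Qed.

Let liftU x y : lift << (x, y) >> = phi x y.
Proof. by rewrite /lift freeg.liftU scale1r. Qed.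

Let lift_null u : tensor_null u -> lift u = 0.
Proof.
case: phiB => phiDl phiDr phiZ.
elim=> [|v w _ v0 _ w0|x x' y|x y y'|x a y].
- by rewrite -[0 in LHS](subrr 0) liftB subrr.
- by rewrite liftB v0 w0 subrr.
- by rewrite !liftB !liftU phiDl -addrA -opprD subrr.
- by rewrite !liftB !liftU phiDr -addrA -opprD subrr.
- by rewrite liftB !liftU phiZ subrr.
Qed.

Let lift_repr (u : F) :
  lift (repr (piQ u)) = lift u.
Proof.
apply/eqP; rewrite -subr_eq0 -liftB; apply/eqP/lift_null/asboolP.
suff: repr (piQ u) - u \in tensor_nullb by [].
by rewrite Quotient.idealrBE reprK.
Qed.

Lemma tensor_liftE x y : tensor_lift (tens x y) = phi x y.
Proof. by rewrite /tensor_lift lift_repr liftU. Qed.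

Lemma tensor_liftB : {morph tensor_lift : u v / u - v}.
Proof.
move=> u v; rewrite /tensor_lift -liftB.
have reK (w : tensor) : piQ (repr (w : Quotient.quot tensor_nullb)) = w.
  exact: (@reprK _ (Quotient.quot tensor_nullb) w).
rewrite -[RHS]lift_repr; congr (lift (repr _)).
by rewrite -[u in LHS]reK -[v in LHS]reK -raddfB.
Qed.

Lemma tensor_lift0 : tensor_lift 0 = 0.
Proof. by rewrite -[0 in LHS](subrr 0) tensor_liftB subrr. Qed.

Lemma tensor_liftD : {morph tensor_lift : u v / u + v}.
Proof.
move=> u v; rewrite -[v in LHS]opprK tensor_liftB -[- v]sub0r tensor_liftB.
by rewrite tensor_lift0 sub0r opprK.
Qed.

End Lift.

Let tscale (t : T) : tensor -> tensor := tensor_lift (fun x y => tens (t *: x) y).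
Let trscale (u : tensor) (s : S) : tensor :=
  tensor_lift (fun x y => tens x (y ** s)) u.

Fact tscale_balanced t : balanced (fun x y => tens (t *: x) y).
Proof.
split=> [x x' y|x y y'|x a y]; first by rewrite scalerDr tensDl.
- exact: tensDr.
- by rewrite scalerscaleA tensZ.
Qed.

Fact trscale_balanced s : balanced (fun x y => tens x (y ** s)).
Proof.
split=> [x x' y|x y y'|x a y]; first exact: tensDl.
- by rewrite rscaleDl tensDr.
- by rewrite tensZ scalerscaleA.
Qed.

Let tscaleE t x y : tscale t (tens x y) = tens (t *: x) y.
Proof. exact/tensor_liftE/tscale_balanced. Qed.
Let trscaleE x y s : trscale (tens x y) s = tens x (y ** s).
Proof. exact/tensor_liftE/trscale_balanced. Qed.
Let tscale0 t : tscale t 0 = 0.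
Proof. exact/tensor_lift0/tscale_balanced. Qed.
Let trscale0 s : trscale 0 s = 0.
Proof. exact/tensor_lift0/trscale_balanced. Qed.

Fact tscaleDr : right_distributive tscale +%R.
Proof. by move=> t; apply/tensor_liftD/tscale_balanced. Qed.
Fact trscaleDl u v s : trscale (u + v) s = trscale u s + trscale v s.
Proof. exact/tensor_liftD/trscale_balanced. Qed.

Fact tscaleA t t' u : tscale t (tscale t' u) = tscale (t * t') u.
Proof.
elim/tensor_ind: u => [|u v Hu Hv|x y]; first by rewrite !tscale0.
  by rewrite !tscaleDr Hu Hv.
by rewrite !tscaleE scalerA.
Qed.
Fact tscale1 : left_id 1 tscale.
Proof.
elim/tensor_ind=> [|u v Hu Hv|x y]; first exact: tscale0.
  by rewrite tscaleDr Hu Hv.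
by rewrite tscaleE scale1r.
Qed.
Fact tscaleDl u : {morph tscale^~ u : t t' / t + t'}.
Proof.
move=> t t' /=; elim/tensor_ind: u => [|u v Hu Hv|x y].
- by rewrite !tscale0 addr0.
- by rewrite !tscaleDr Hu Hv addrACA.
- by rewrite !tscaleE scalerDl tensDl.
Qed.

HB.instance Definition _ := GRing.Zmodule_isLmodule.Build T tensor
  tscaleA tscale1 tscaleDr tscaleDl.

Fact trscaleA u s s' : trscale (trscale u s) s' = trscale u (s * s').
Proof.
elim/tensor_ind: u => [|u v Hu Hv|x y]; first by rewrite !trscale0.
  by rewrite !trscaleDl Hu Hv.
by rewrite !trscaleE rscaleA.
Qed.
Fact trscale1 u : trscale u 1 = u.
Proof.
elim/tensor_ind: u => [|u v Hu Hv|x y]; first exact: trscale0.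
  by rewrite trscaleDl Hu Hv.
by rewrite trscaleE rscale1.
Qed.
Fact trscaleDr u s s' : trscale u (s + s') = trscale u s + trscale u s'.
Proof.
elim/tensor_ind: u => [|u v Hu Hv|x y].
- by rewrite !trscale0 addr0.
- by rewrite !trscaleDl Hu Hv addrACA.
- by rewrite !trscaleE rscaleDr tensDr.
Qed.
Fact tscale_trscaleA (t : T) u s : t *: trscale u s = trscale (t *: u) s.
Proof.
rewrite /GRing.scale /=.
elim/tensor_ind: u => [|u v Hu Hv|x y].
- by rewrite trscale0 tscale0 trscale0.
- by rewrite trscaleDl !tscaleDr Hu Hv trscaleDl.
- by rewrite trscaleE !tscaleE trscaleE.
Qed.

HB.instance Definition _ := Lmodule_isBimodule.Build T S tensor
  trscaleA trscale1 trscaleDl trscaleDr tscale_trscaleA.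

Lemma scale_tens (t : T) x y : t *: tens x y = tens (t *: x) y.
Proof. exact: tscaleE. Qed.
Lemma rscale_tens x y (s : S) : tens x y ** s = tens x (y ** s).
Proof. exact: trscaleE. Qed.

End Tensor.

Section Evaluation.
Context (T R : pzRingType) (M : bimodType T R).

(* m (x) f |-> (m)f *)
Definition tensor_ev : tensor M (lhom M T^o) -> T^o :=
  tensor_lift (fun (x : M) (f : lhom M T^o) => f x).

Fact tensor_ev_balanced : balanced (fun (x : M) (f : lhom M T^o) => f x).
Proof. by split=> // x x' f; rewrite linearD. Qed.

Lemma tensor_evE x (f : lhom M T^o) : tensor_ev (tens x f) = f x.
Proof. exact/tensor_liftE/tensor_ev_balanced. Qed.

Let ev0 : tensor_ev 0 = 0.
Proof. exact/tensor_lift0/tensor_ev_balanced. Qed.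
Let evD : {morph tensor_ev : u v / u + v}.
Proof. exact/tensor_liftD/tensor_ev_balanced. Qed.

Fact tensor_ev_linear : linear tensor_ev.
Proof.
move=> t u v; rewrite evD; congr (_ + _).
elim/tensor_ind: u => [|u w Hu Hw|x f]; first by rewrite scaler0 ev0 scaler0.
  by rewrite scalerDr !evD Hu Hw scalerDr.
by rewrite scale_tens !tensor_evE linearZ.
Qed.
HB.instance Definition _ :=
  GRing.isLinear.Build T (tensor M (lhom M T^o)) T^o *:%R tensor_ev
    tensor_ev_linear.

Lemma tensor_ev_rscalable : rscalable tensor_ev.
Proof.
move=> u t; elim/tensor_ind: u => [|u w Hu Hw|x f].
- by rewrite rscale0l ev0 rscale0l.
- by rewrite rscaleDl !evD Hu Hw rscaleDl.
- by rewrite rscale_tens !tensor_evE.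
Qed.

End Evaluation.

(* A section exhibits [tensor_ev] as a split epimorphism of T-bimodules. *)
Definition M_separable (T R : pzRingType) (M : bimodType T R) : Prop :=
  exists s : {linear T^o -> tensor M (lhom M T^o)},
    rscalable s /\ cancel s (@tensor_ev T R M).

Definition finitely_generated (R : pzRingType) (V : lmodType R) : Prop :=
  exists (n : nat) (v : 'I_n -> V),
    forall x, exists c : 'I_n -> R, x = \sum_i c i *: v i.

Definition projective (R : pzRingType) (V : lmodType R) : Prop :=
  forall (A B : lmodType R) (g : {linear A -> B}) (f : {linear V -> B}),
    (forall b, exists a, g a = b) ->
    exists h : {linear V -> A}, forall x, g (h x) = f x.

Definition frobenius (T R : pzRingType) (M : bimodType T R) : Prop :=
  [/\ finitely_generated (rmod M) /\ projective (rmod M),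
      finitely_generated M /\ projective M
    & exists phi : {linear lhom M T^o -> rdual M}, rscalable phi /\ bijective phi].

(* f . q : m' |-> (m')f q *)
Section DualAction.
Context (T R : pzRingType) (M : bimodType T R) (Q : lmodType T).

Definition ldual_act_fun (f : lhom M T^o) (q : Q) (x : M) : Q := (f x : T) *: q.

Fact ldual_act_fun_linear f q : linear (ldual_act_fun f q).
Proof.
by move=> t x y; rewrite /ldual_act_fun linearP scalerDl -scalerA.
Qed.
HB.instance Definition _ f q :=
  GRing.isLinear.Build T M Q *:%R (ldual_act_fun f q) (ldual_act_fun_linear f q).
Definition ldual_act (f : lhom M T^o) (q : Q) : lhom M Q := ldual_act_fun f q.

End DualAction.

Record category := Category {
  obj :> Type;
  hom : obj -> obj -> Type;
  idm : forall X, hom X X;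
  compm : forall X Y Z, hom Y Z -> hom X Y -> hom X Z;
  compmA : forall X Y Z W (h : hom Z W) (g : hom Y Z) (f : hom X Y),
    compm h (compm g f) = compm (compm h g) f;
  comp1m : forall X Y (f : hom X Y), compm (idm Y) f = f;
  compm1 : forall X Y (f : hom X Y), compm f (idm X) = f
}.

Record functor (A B : category) := Functor {
  fobj :> A -> B;
  fmap : forall X Y, hom X Y -> hom (fobj X) (fobj Y);
  fmap1 : forall X, fmap (idm X) = idm (fobj X);
  fmapM : forall X Y Z (g : hom Y Z) (f : hom X Y),
    fmap (compm g f) = compm (fmap g) (fmap f)
}.

(* [P] is natural in both arguments and left inverse to f |-> G(f). *)
Definition separable_functor (A B : category) (G : functor A B) : Prop :=
  exists P : forall X Y : A, hom (G X) (G Y) -> hom X Y,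
    (forall X X' Y Y' (f : hom X' X) (g : hom (G X) (G Y)) (h : hom Y Y'),
       P X' Y' (compm (fmap G h) (compm g (fmap G f)))
       = compm h (compm (P X Y g) f)) /\
    (forall X Y (f : hom X Y), P X Y (fmap G f) = f).

Section ModuleCategory.
Context (T : pzRingType).

Definition lmod_comp (X Y Z : lmodType T) (g : {linear Y -> Z})
    (f : {linear X -> Y}) : {linear X -> Z} :=
  GRing.Linear.clone _ _ _ _ (g \o f) _.
Definition lmod_id (X : lmodType T) : {linear X -> X} :=
  GRing.Linear.clone _ _ _ _ (@idfun X) _.

Fact lmod_compA (X Y Z W : lmodType T) (h : {linear Z -> W})
    (g : {linear Y -> Z}) (f : {linear X -> Y}) :
  lmod_comp h (lmod_comp g f) = lmod_comp (lmod_comp h g) f.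
Proof. exact: linear_ext. Qed.
Fact lmod_comp1m (X Y : lmodType T) (f : {linear X -> Y}) :
  lmod_comp (lmod_id Y) f = f.
Proof. exact: linear_ext. Qed.
Fact lmod_compm1 (X Y : lmodType T) (f : {linear X -> Y}) :
  lmod_comp f (lmod_id X) = f.
Proof. exact: linear_ext. Qed.

Definition lmod_cat : category := Category lmod_compA lmod_comp1m lmod_compm1.

End ModuleCategory.

Section LeftHomFunctor.
Context (T R : pzRingType) (M : bimodType T R).

Definition lhom_map_fun (X Y : lmodType T) (h : {linear X -> Y}) (f : lhom M X) :
  lhom M Y := lmod_comp h f.

Fact lhom_map_fun_linear X Y h : linear (@lhom_map_fun X Y h).
Proof. by move=> a f g; apply: linear_ext => x; apply: linearD. Qed.
HB.instance Definition _ X Y h :=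
  GRing.isLinear.Build R (lhom M X) (lhom M Y) *:%R (@lhom_map_fun X Y h)
    (@lhom_map_fun_linear X Y h).
Definition lhom_map (X Y : lmodType T) (h : {linear X -> Y}) :
  {linear lhom M X -> lhom M Y} := @lhom_map_fun X Y h.

Fact lhom_map1 (X : lmodType T) : lhom_map (lmod_id X) = lmod_id (lhom M X).
Proof. by apply: linear_ext => f; apply: linear_ext. Qed.
Fact lhom_mapM (X Y Z : lmodType T) (h : {linear Y -> Z}) (g : {linear X -> Y}) :
  lhom_map (lmod_comp h g) = lmod_comp (lhom_map h) (lhom_map g).
Proof. by apply: linear_ext => f; apply: linear_ext. Qed.

Definition lhom_functor : functor (lmod_cat T) (lmod_cat R) :=
  @Functor (lmod_cat T) (lmod_cat R) (fun X => lhom M X : lmodType R)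
    lhom_map lhom_map1 lhom_mapM.

End LeftHomFunctor.

(* Main.v *)
Require Import Defs.
From HB Require Import structures.
From mathcomp Require Import all_boot all_algebra.

Set Implicit Arguments.
Unset Strict Implicit.
Unset Printing Implicit Defensive.

Import GRing.Theory.
Local Open Scope ring_scope.

(** Write G for the functor Hom(_T M, _T -).  Everything goes through the
    central elements of the T-bimodule M (x) *M, those u with t u = u t for
    every t in T.  A T-bimodule map out of T is the same thing as a central
    element, its value at 1, so T is M-separable exactly when some central u
    evaluates to 1 (lemma M_separableP).

    A central element u = sum_j x_j (x) g_j turns any R-linear map
    phi : G X -> G Y into a T-linear map X -> Y, by averaging:
      x |-> sum_j (x_j) phi(g_j . x),    where (m)(g_j . x) = (m)g_j x.
    Additivity and R-linearity of phi make the sum well defined on the tensor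
    product, and centrality of u makes the average T-linear.  The average is
    natural in X and Y, and the average of G(h) is x |-> h (ev(u) x).  Hence,
    if ev(u) = 1, averaging is a natural retraction of the action of G on
    morphisms, and G is separable.  Averaging (nu h) id over the h in
    Hom(M, M) gives alpha(m) = sum_j x_j nu(g_j . m), and the dual basis
    formula for the g_j turns sum_i (alpha(m_i)) f_i into ev(u).

    Conversely, a natural retraction of G on morphisms, applied to the
    coevaluation G T = *M -> G (M (x) *M), g |-> (m |-> m (x) g), is a section
    of the evaluation: the coevaluation becomes the identity after G(ev).  And
    if alpha is a bimodule map with sum_i (alpha(m_i)) f_i = 1, then
    (alpha (x) id)(e) is central, because e is, and evaluates to 1. *)

(** * Central elements of a tensor product *)

Section TensorMaps.
Context (T R S : pzRingType) (M : bimodType T R) (N : bimodType R S).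

Lemma tensor_additive_ext (A : zmodType) (F G : tensor M N -> A) :
  {morph F : u v / u + v} -> {morph G : u v / u + v} ->
  (forall x y, F (tens x y) = G (tens x y)) -> F =1 G.
Proof.
move=> FD GD FG; elim/tensor_ind => [|u v Hu Hv|x y].
- have add0 (H : tensor M N -> A) : {morph H : u v / u + v} -> H 0 = 0.
    by move=> HD; apply: (addrI (H 0)); rewrite -HD !addr0.
  by rewrite !add0.
- by rewrite FD GD Hu Hv.
- exact: FG.
Qed.

Section MapLeft.
Context (L : bimodType T R) (alpha : {linear M -> L}).
Hypothesis alphaZ : rscalable alpha.

Definition tensor_mapl : tensor M N -> tensor L N :=
  tensor_lift (fun x y => tens (alpha x) y).

Fact tensor_mapl_balanced :
  balanced (fun (x : M) (y : N) => tens (alpha x) y).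
Proof.
split=> [x x' y|x y y'|x a y]; first by rewrite linearD tensDl.
- exact: tensDr.
- by rewrite alphaZ tensZ.
Qed.

Lemma tensor_maplE x y : tensor_mapl (tens x y) = tens (alpha x) y.
Proof. exact: (tensor_liftE tensor_mapl_balanced). Qed.

Lemma tensor_maplD : {morph tensor_mapl : u v / u + v}.
Proof. exact: (tensor_liftD tensor_mapl_balanced). Qed.

Lemma tensor_maplZ t u : tensor_mapl (t *: u) = t *: tensor_mapl u.
Proof.
move: u; apply: tensor_additive_ext => [u v|u v|x y].
- by rewrite scalerDr tensor_maplD.
- by rewrite tensor_maplD scalerDr.
- by rewrite scale_tens !tensor_maplE linearZ scale_tens.
Qed.

Lemma tensor_mapl_rscalable : rscalable tensor_mapl.
Proof.
move=> u s; move: u; apply: tensor_additive_ext => [u v|u v|x y].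
- by rewrite rscaleDl tensor_maplD.
- by rewrite tensor_maplD rscaleDl.
- by rewrite rscale_tens !tensor_maplE rscale_tens.
Qed.

Lemma tensor_mapl_sum (I : finType) (x : I -> M) (y : I -> N) :
  tensor_mapl (\sum_i tens (x i) (y i)) = \sum_i tens (alpha (x i)) (y i).
Proof.
have mapl0 := tensor_lift0 tensor_mapl_balanced.
rewrite (big_morph tensor_mapl tensor_maplD mapl0).
by apply: eq_bigr => i _; apply: tensor_maplE.
Qed.

End MapLeft.

(** The unit of the adjunction between M (x) - and Hom(M, -). *)
Definition coev_fun (y : N) (x : M) : tensor M N := tens x y.

Fact coev_fun_linear y : linear (coev_fun y).
Proof. by move=> t x x'; rewrite /coev_fun tensDl scale_tens. Qed.
HB.instance Definition _ y :=
  GRing.isLinear.Build T M (tensor M N) *:%R (coev_fun y) (coev_fun_linear y).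
Definition coev (y : N) : lhom M (tensor M N) := coev_fun y.

Fact coev_linear : linear coev.
Proof.
move=> a y y'; apply: linear_ext => x.
by rewrite [LHS]tensDr -tensZ.
Qed.
HB.instance Definition _ :=
  GRing.isLinear.Build R N (lhom M (tensor M N)) *:%R coev coev_linear.

End TensorMaps.

Section RightMultiplication.
Context (T S : pzRingType) (B : bimodType T S) (s : S).

Definition rmult (x : B) : B := x ** s.

Fact rmult_linear : linear rmult.
Proof. by move=> t x y; rewrite /rmult rscaleDl scalerscaleA. Qed.
HB.instance Definition _ :=
  GRing.isLinear.Build T B B *:%R rmult rmult_linear.

End RightMultiplication.

Definition central (T : pzRingType) (B : bimodType T T) (u : B) :=
  forall t : T, t *: u = u ** t.

(** The section attached to u is t |-> t u; conversely u is the value of the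
    section at 1, which is central because t 1 = 1 t. *)
Lemma M_separableP (T R : pzRingType) (M : bimodType T R) :
  M_separable M <->
  exists2 u : tensor M (lhom M T^o), central u & tensor_ev u = 1.
Proof.
split=> [[s [sZ sK]]|[u uC u1]].
  exists (s 1); last exact: sK.
  move=> t; rewrite -linearZ -sZ; congr (s _).
  exact: (etrans (mulr1 t) (esym (mul1r t))).
have s_linear : linear (fun t : T^o => (t : T) *: u).
  by move=> a t t'; rewrite scalerDl -scalerA.
pose s : {linear T^o -> tensor M (lhom M T^o)} :=
  HB.pack (fun t : T^o => (t : T) *: u)
    (GRing.isLinear.Build T T^o _ *:%R _ s_linear).
exists s; split=> [t a|t]; rewrite /s /=.
  (* (t u) a = t (u a) = t (a u) = (t a) u *)
  by rewrite -scalerscaleA -uC scalerA.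
by rewrite linearZ /= u1; apply: mulr1.
Qed.

(** * Averaging R-linear maps over a central element *)

Section Average.
Context (T R : pzRingType) (M : bimodType T R) (X Y : lmodType T).
Implicit Types (u : tensor M (lhom M T^o)).
Implicit Types (phi : {linear lhom M X -> lhom M Y}).

(** For u = sum_j x_j (x) g_j this is x |-> sum_j (x_j) phi(g_j . x).  It is
    defined for every u, central or not, because identities between averages
    are checked on pure tensors, which are seldom central. *)
Definition average_fun u phi (x : X) : Y :=
  tensor_lift (fun m (g : lhom M T^o) => phi (ldual_act g x) m) u.

Fact average_balanced phi (x : X) :
  balanced (fun (m : M) (g : lhom M T^o) => phi (ldual_act g x) m).
Proof.
split=> [m m' g|m g g'|m a g]; first exact: linearD.
- rewrite -lhomDE -linearD; congr (phi _ m).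
  by apply: linear_ext => m'; apply: scalerDl.
- rewrite -lhomZE -linearZ; congr (phi _ m).
  exact: linear_ext.
Qed.

Lemma average_tens phi m g x :
  average_fun (tens m g) phi x = phi (ldual_act g x) m.
Proof. exact: (tensor_liftE (average_balanced phi x)). Qed.

Lemma average_tensorD phi x :
  {morph (fun u => average_fun u phi x) : u v / u + v}.
Proof. by move=> u v; apply: (tensor_liftD (average_balanced phi x)). Qed.

(** Multiplying v by t on the left multiplies the average by t, as phi takes
    values in T-linear maps.  Multiplying v by t on the right replaces g_j by
    g_j t, that is, x by t x, as (g t) . x = g . (t x).  Centrality equates the
    two. *)
Fact average_linear u (uC : central u) phi : linear (average_fun u phi).
Proof.
have shift v t x : average_fun (v ** t) phi x = average_fun v phi (t *: x).
  move: v; apply: tensor_additive_ext => [v w|v w|m g].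
  - by rewrite rscaleDl average_tensorD.
  - exact: average_tensorD.
  - rewrite rscale_tens !average_tens; congr (phi _ m).
    by apply: linear_ext => m'; apply/esym/scalerA.
have scale v t x : average_fun (t *: v) phi x = t *: average_fun v phi x.
  move: v; apply: tensor_additive_ext => [v w|v w|m g].
  - by rewrite scalerDr average_tensorD.
  - by rewrite average_tensorD scalerDr.
  - by rewrite scale_tens !average_tens linearZ.
move=> t x y; rewrite -scale uC shift.
move: (t *: x) {uC} => {}x; move: u.
apply: tensor_additive_ext => [v w|v w|m g].
- exact: average_tensorD.
- by rewrite !average_tensorD addrACA.
- rewrite !average_tens -lhomDE -linearD; congr (phi _ m).
  by apply: linear_ext => m'; apply: scalerDr.
Qed.

Definition average u (uC : central u) phi : {linear X -> Y} :=
  HB.pack (average_fun u phi)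
    (GRing.isLinear.Build T X Y *:%R _ (average_linear uC phi)).

End Average.

(** * Separability of the functor *)

(** Averaging is the retraction.  It is natural because g . x followed by a
    T-linear map k is g . k(x), and the average of G(h) at x is
    sum_j h ((x_j)g_j x) = h (ev(u) x). *)
Lemma central_separable_functor (T R : pzRingType) (M : bimodType T R)
    (u : tensor M (lhom M T^o)) :
  central u -> tensor_ev u = 1 -> separable_functor (lhom_functor M).
Proof.
move=> uC u1; exists (fun X Y phi => average uC phi); split.
  move=> X X' Y Y' k phi h; apply: linear_ext => x.
  suff: average_fun u
      (lmod_comp (lhom_map M h) (lmod_comp phi (lhom_map M k))) x =
    h (average_fun u phi (k x)) by [].
  move: (u); apply: tensor_additive_ext => [v w|v w|m g].
  - exact: average_tensorD.
  - by rewrite average_tensorD linearD.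
  - rewrite !average_tens; congr (h (phi _ m)).
    by apply: linear_ext => m'; apply: linearZ.
move=> X Y h; apply: linear_ext => x.
suff: average_fun u (lhom_map M h) x = h ((tensor_ev u : T) *: x).
  by rewrite u1 scale1r.
move: (u); apply: tensor_additive_ext => [v w|v w|m g].
- exact: average_tensorD.
- by rewrite linearD scalerDl linearD.
- by rewrite average_tens tensor_evE.
Qed.

(** Since G(ev) after the coevaluation of *M is the identity of G T, the
    retraction P sends the coevaluation to a section s of ev.  Both s (t a) and
    s(t) a come from naturality of P, along right multiplication by a on T and
    on M (x) *M, and the coevaluation intertwines these two. *)
Lemma separable_functor_M_separable (T R : pzRingType) (M : bimodType T R) :
  separable_functor (lhom_functor M) -> M_separable M.
Proof.
move=> [P [Pnat PK]].
have PG X Y Y' (phi : Defs.hom (lhom_functor M X) (lhom_functor M Y))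
    (h : Defs.hom Y Y') :
    P X Y' (compm (fmap (lhom_functor M) h) phi) = compm h (P X Y phi).
  by have := Pnat X X Y Y' (idm X) phi h; rewrite fmap1 !compm1.
have GP X X' Y (phi : Defs.hom (lhom_functor M X) (lhom_functor M Y))
    (k : Defs.hom X' X) :
    P X' Y (compm phi (fmap (lhom_functor M) k)) = compm (P X Y phi) k.
  by have := Pnat X X' Y Y k phi (idm Y); rewrite fmap1 !comp1m.
pose MM : bimodType T T := tensor M (lhom M T^o).
pose eta : {linear lhom M T^o -> lhom M MM} := @coev T R T M (lhom M T^o).
pose s : {linear T^o -> MM} := P T^o MM eta.
pose ev : {linear MM -> T^o} := @tensor_ev T R M.
have ext (V W : lmodType T) (h k : {linear V -> W}) x : h = k -> h x = k x.
  by move=> ->.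
exists s; split=> [t a|t].
  pose rT : {linear T^o -> T^o} := rmult a.
  pose rM : {linear MM -> MM} := rmult a.
  suff /(ext _ _ _ _ t) : lmod_comp s rT = lmod_comp rM s by [].
  rewrite -[LHS](GP T^o T^o MM eta rT) -[RHS](PG T^o MM MM eta rM).
  congr (P _ _ _); apply: linear_ext => g; apply: linear_ext => m.
  apply: (etrans _ (esym (rscale_tens m g a))).
  by congr (tens m _); apply: linear_ext.
suff /(ext _ _ _ _ t) : lmod_comp ev s = lmod_id T^o by [].
rewrite -[LHS](PG T^o MM T^o eta ev) -[RHS](PK T^o T^o (lmod_id T^o)).
congr (P _ _ _); apply: linear_ext => g; apply: linear_ext => m.
exact: tensor_evE.
Qed.

(** * The endomorphism attached to nu *)

Section ScalarEndomorphism.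
Context (T R : pzRingType) (M : bimodType T R) (nu : {linear lhom M M -> R^o}).

(** The R-linear map whose average over u = sum_j x_j (x) g_j is
    m |-> sum_j x_j nu(g_j . m), the bimodule map attached to u. *)
Definition scalar_end (h : lhom M M) : lhom M M :=
  (nu h : R) *: (lmod_id M : lhom M M).

Fact scalar_end_linear : linear scalar_end.
Proof. by move=> a h k; rewrite /scalar_end linearP scalerDl -scalerA. Qed.
HB.instance Definition _ :=
  GRing.isLinear.Build R (lhom M M) (lhom M M) *:%R scalar_end
    scalar_end_linear.

Lemma scalar_endE h x : scalar_end h x = x ** (nu h : R).
Proof. by []. Qed.

Hypothesis nuZ : rscalable nu.

Lemma average_scalar_end_rscalable (u : tensor M (lhom M T^o)) :
  rscalable (average_fun u scalar_end).
Proof.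
move=> x a; move: u; apply: tensor_additive_ext => [u v|u v|m g].
- exact: average_tensorD.
- by rewrite average_tensorD rscaleDl.
- rewrite !average_tens !scalar_endE rscaleA; congr (m ** _).
  rewrite -[RHS]nuZ; congr (nu _).
  by apply: linear_ext => m'; apply: scalerscaleA.
Qed.

End ScalarEndomorphism.

Theorem proposition5p15 (T R : pzRingType) (M : bimodType T R)
    (n : nat) (m : 'I_n -> M) (f : 'I_n -> lhom M T^o)
    (e : tensor M (lhom M T^o)) (nu : {linear lhom M M -> R^o}) :
  frobenius M ->
  e = \sum_(i < n) tens (m i) (f i) ->
  (forall t : T, t *: e = e ** t) ->
  rscalable nu ->
  (forall x : M, x = \sum_(i < n) m i ** (nu (ldual_act (f i) x) : R)) ->
  (forall g : lhom M T^o, g = \sum_(i < n) (nu (ldual_act g (m i)) : R) *: f i) ->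
  (M_separable M <-> separable_functor (lhom_functor M)) /\
  (M_separable M <->
     exists alpha : {linear M -> M},
       rscalable alpha /\ \sum_(i < n) (f i (alpha (m i)) : T) = 1).
Proof.
move=> _ eE eC nuZ _ fE; split; split.
- by move=> /M_separableP[u uC u1]; apply: central_separable_functor uC u1.
- exact: separable_functor_M_separable.
- move=> /M_separableP[u uC u1]; exists (average uC (scalar_end nu)).
  split; first exact: average_scalar_end_rscalable.
  rewrite -[RHS]u1.
  (* On x (x) g the sum is sum_i (x nu(g . m_i)) f_i, the value at x of the
     expansion of g in the dual basis f_i. *)
  have sumE : forall v,
      \sum_(i < n) f i (average_fun v (scalar_end nu) (m i)) = tensor_ev v.
    apply: tensor_additive_ext => [v w|v w|x g].
    + rewrite -big_split; apply: eq_bigr => i _.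
      by rewrite average_tensorD linearD.
    + exact: linearD.
    + rewrite tensor_evE [in RHS](fE g) (big_morph (fun h : lhom M T^o => h x)
        (fun h k => lhomDE h k x) (lhom0E _ x)).
      by apply: eq_bigr => i _; rewrite average_tens scalar_endE.
  exact: sumE.
- move=> [alpha [alphaZ alpha1]]; apply/M_separableP.
  exists (tensor_mapl alpha e) => [t|].
    by rewrite -tensor_maplZ // eC tensor_mapl_rscalable.
  rewrite eE tensor_mapl_sum // linear_sum -[RHS]alpha1.
  by apply: eq_bigr => i _; apply: tensor_evE.
Qed.
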